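(* Let $n$ be a nonnegative integer and let $a,b,c$ be complex numbers such that no lower parameter of the series below is a nonpositive integer and all denominators below are nonzero. Then $$\frac{(c-a)_n(a-b)_n}{(c-1)_n(1-b)_n}={}_7F_6\left[\begin{matrix}-\frac n2,\ \frac{1-n}{2},\ \frac{1-a}{2},\ \frac{2-a}{2},\ c-a,\ b+c-a,\ a-b-c+1\\ \frac12,\ \frac{1-b}{2},\ \frac{2-b}{2},\ c-1,\ 2-c-n,\ c-a+n\end{matrix};1\right]$$ $$-\frac{n(1-a)(c-a+1)(a-b-c+1)}{(1-b)(1-c)(c-a+n)}\;{}_8F_7\left[\begin{matrix}\frac{1-n}{2},\ \frac{2-n}{2},\ 1+\frac{c-a+1}{3},\ \frac{2-a}{2},\ \frac{3-a}{2},\ c-a,\ b+c-a,\ a-b-c+2\\ \frac32,\ \frac{c-a+1}{3},\ \frac{2-b}{2},\ \frac{3-b}{2},\ c,\ 2-c-n,\ c-a+n+1\end{matrix};1\right].$$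
   Context: $(x)_0=1$ and $(x)_n=x(x+1)\cdots(x+n-1)$ for $n\ge1$. The generalized hypergeometric series is ${}_pF_q\left[\begin{matrix}a_1,\dots,a_p\\ b_1,\dots,b_q\end{matrix};z\right]=\sum_{k\ge0}\frac{(a_1)_k\cdots(a_p)_k}{(b_1)_k\cdots(b_q)_k}\frac{z^k}{k!}$, with lower parameters $b_j\in\mathbb{C}\setminus\mathbb{Z}_{\le0}$. The series involved terminate; a term whose coefficient vanishes because of the factor $n$ (when $n=0$) is read as $0$. *)

(* Defs.v *)
From mathcomp Require Import all_boot all_order all_algebra.
From mathcomp Require Import complex.
From mathcomp Require Import all_classical all_reals all_analysis.
Set Implicit Arguments.
Unset Strict Implicit.
Unset Printing Implicit Defensive.
Import Order.TTheory GRing.Theory Num.Theory.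
Import numFieldNormedType.Exports.
Local Open Scope ring_scope.
Local Open Scope complex_scope.
Local Open Scope classical_set_scope.

Definition pochhammer (C : nzRingType) (x : C) (n : nat) : C :=
  \prod_(0 <= i < n) (x + i%:R).

Definition nonpos_integer (C : nzRingType) (x : C) : Prop :=
  exists m : nat, x = - m%:R.

Definition hypergeom_term (C : fieldType) (us ls : seq C) (z : C)
    (k : nat) : C :=
  (\prod_(u <- us) pochhammer u k) / (\prod_(l <- ls) pochhammer l k)
    * (z ^+ k / k`!%:R).

(* The sum of pFq[us; ls; z], with p = size us and q = size ls, as the limit
   in C = R[i] of the partial sums of the full infinite series. A series that
   does not converge gets an unspecified value, so that 0 times it is 0. *)
Definition hypergeom (R : realType) (us ls : seq R[i]) (z : R[i]) : R[i] :=
  limn (series (hypergeom_term us ls z : (R[i]^o)^nat)).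

(* Main.v *)
Require Import Defs.
From mathcomp Require Import all_boot all_order all_algebra.
From mathcomp Require Import complex ring.
From mathcomp Require Import all_classical all_reals all_analysis.
Import Order.TTheory GRing.Theory Num.Theory.
Import numFieldNormedType.Exports.
Local Open Scope ring_scope.
Local Open Scope complex_scope.

(** The formula is an inverted Pfaff-Saalschütz sum.

    The two series on the right interlace.  With (x)_k for the Pochhammer
    symbol, pairs of parameters x/2, (x+1)/2 turn (x/2)_k ((x+1)/2)_k into
    (x)_{2k} / 4^k, so that the k-th term of the 7F6 carries the binomial
    coefficient C(n, 2k) and the k-th term of the 8F7, once multiplied by its
    prefactor, carries C(n, 2k+1) ([term_7F6], [term_8F7]).  The right-hand
    side is thus one sum over j <= n, of the shape
      sum_j (-1)^j C(n,j) (a_j + j b_j) / phi(n;j+1) f(j),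
    where phi(x;m) is the product of the affine factors a_i + x b_i, i < m.
    Here the factors are 1-c, c-a+x, 2-c-x, c-a+x+1, 3-c-x, and so on,
    alternating between the two arithmetic progressions ([prod_factorS]).

    Such a sum is inverted by Gould-Hsu ([gould_hsu]): it equals g(n) as soon as
      f(m) = sum_i (-1)^i C(m,i) phi(i;m) g(i)   for all m <= n.
    Take g(i) = (c-a)_i (a-b)_i / ((c-1)_i (1-b)_i), the left-hand side.
    Multiplying g(i) by phi(i;m) only shifts its parameters c-a and c-1, and
    the shifts add up to m-1, exactly what makes the sum for f(m) a balanced
    3F2; Pfaff-Saalschütz ([saalschutz]) then gives the closed form of f(m)
    ([binomial_transform]), whose even and odd values are the coefficients of
    the 7F6 and of the 8F7.

    The inversion needs the affine factors to be nonzero at x = n only, so the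
    argument covers the degenerate parameters (such as c-a a negative integer above -n)
    for which the formula makes no sense at some smaller n. *)

(** * Pochhammer symbols *)

Lemma pochhammer0 (C : nzRingType) (x : C) : pochhammer x 0 = 1.
Proof. by rewrite /pochhammer big_geq. Qed.

Lemma pochhammerS (C : nzRingType) (x : C) n :
  pochhammer x n.+1 = pochhammer x n * (x + n%:R).
Proof. by rewrite /pochhammer big_nat_recr. Qed.

Lemma pochhammerD (C : nzRingType) (x : C) m n :
  pochhammer x (m + n) = pochhammer x m * pochhammer (x + m%:R) n.
Proof.
elim: n => [|n IH]; first by rewrite addn0 pochhammer0 mulr1.
by rewrite addnS !pochhammerS IH mulrA natrD addrA.
Qed.

Lemma pochhammerSl (C : nzRingType) (x : C) n :
  pochhammer x n.+1 = x * pochhammer (x + 1) n.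
Proof. by rewrite -add1n pochhammerD pochhammerS pochhammer0 mul1r addr0. Qed.

(** Reversing the order of the factors. *)
Lemma pochhammerN (C : comNzRingType) (x : C) n :
  pochhammer (1 - x - n%:R) n = (-1) ^+ n * pochhammer x n.
Proof.
elim: n => [|n IH]; first by rewrite !pochhammer0 mulr1.
rewrite pochhammerSl pochhammerS exprS.
have -> : 1 - x - n.+1%:R + 1 = 1 - x - n%:R by rewrite -natr1; ring.
by rewrite IH -natr1; ring.
Qed.

Lemma pochhammer_neq0 (F : fieldType) (x : F) n :
  (forall i, (i < n)%N -> x + i%:R != 0) -> pochhammer x n != 0.
Proof.
elim: n => [|n IH] h; first by rewrite pochhammer0 oner_neq0.
by rewrite pochhammerS mulf_neq0 ?h // IH // => i /ltnW; apply: h.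
Qed.

Lemma pochhammer1 (C : nzRingType) n : pochhammer (1 : C) n = n`!%:R.
Proof.
elim: n => [|n IH]; first by rewrite pochhammer0.
by rewrite pochhammerS IH nat1r -natrM factS mulnC.
Qed.

Lemma pochhammer_oppn (C : comNzRingType) n k :
  pochhammer (- n%:R : C) k = (-1) ^+ k * ('C(n, k) * k`!)%:R.
Proof.
rewrite bin_ffact; elim: k => [|k IH]; first by rewrite pochhammer0 ffactn0 mulr1.
rewrite pochhammerS IH ffactnSr natrM exprS.
have [kn|nk] := leqP k n; first by rewrite natrB //; ring.
by rewrite ffact_small //; ring.
Qed.

Lemma pochhammer_halves (F : numFieldType) (x y z : F) k :
  y = 2 * x -> z = x + 2^-1 ->
  pochhammer x k * pochhammer z k = pochhammer y k.*2 / 4 ^+ k.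
Proof.
move=> -> ->; elim: k => [|k IH]; first by rewrite !pochhammer0 expr0 divr1 mulr1.
rewrite doubleS !pochhammerS exprS mulrACA IH -natr1 -addnn natrD.
by field; rewrite expf_neq0 ?pnatr_eq0.
Qed.

(** * Pfaff-Saalschütz summation *)

(** The Pfaff-Saalschütz sum with denominators cleared, hence valid in every
    commutative ring: dividing by (A+B+E)_m (E)_m gives the balanced series
    3F2(-m, A, B; A+B+E, 1-m-E; 1).  The induction on m is a WZ argument: with
    T m i the summand, T (m+1) i - (A+E+m)(B+E+m) T m i telescopes in i. *)
Lemma saalschutz (C : comNzRingType) (A B E : C) m :
  \sum_(0 <= i < m.+1) 'C(m, i)%:R * (pochhammer A i * pochhammer B i
     * pochhammer E (m - i) * pochhammer (A + B + E + i%:R) (m - i))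
  = pochhammer (A + E) m * pochhammer (B + E) m.
Proof.
elim: m => [|m IH].
  by rewrite big_nat1 !pochhammer0 !mulr1.
rewrite !pochhammerS mulrACA -IH mulr_suml.
pose t i := pochhammer A i * pochhammer B i * pochhammer E (m - i)
   * pochhammer (A + B + E + i%:R) (m - i).
(* The certificate; its value at i = 0 agrees with the convention C(m,-1) = 0. *)
pose G i := if i is i.+1 then
  'C(m, i)%:R * (t i * (A + i%:R) * (B + i%:R)) else 0.
apply/subr0_eq.
(* The last index i = m+1 has no counterpart in the sum for m; it cancels the
   endpoint of the telescoping sum. *)
rewrite big_nat_recr //= subnn !pochhammer0 binn addrAC -sumrB.
rewrite (eq_big_nat _ _ (F2 := fun i => - (G i.+1 - G i))); last first.
  move=> i /andP[_ im]; rewrite ltnS in im; rewrite subSn //.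
  rewrite -[in LHS](subnKC im); set r := (m - i)%N.
  case: i im @r => [|i] im r.
    rewrite /G /t /= !bin0 !pochhammer0 !subn0 add0n.
    have -> : r = m by rewrite /r subn0.
    by rewrite !pochhammerS; ring.
  have tS : t i * (A + i%:R) * (B + i%:R) = pochhammer A i.+1 * pochhammer B i.+1
       * pochhammer E r.+1 * ((A + B + E + i%:R) * pochhammer (A + B + E + i.+1%:R) r).
    rewrite /t; have -> : (m - i)%N = r.+1 by rewrite /r subnS prednK // subn_gt0.
    by rewrite [pochhammer (_ + i%:R) _]pochhammerSl -[i.+1%:R]natr1 addrA !pochhammerS /=; ring.
  rewrite [G i.+1]/G tS /G /t -/r (subnKC im) binS natrD.
  have binE : 'C(m, i.+1)%:R * i.+1%:R = 'C(m, i)%:R * r.+1%:R :> C.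
    by rewrite -!natrM mulnC mul_bin_left mulnC /r subnS prednK // subn_gt0.
  have mE : m%:R = i%:R + 1 + r%:R :> C by rewrite natr1 -natrD subnKC.
  rewrite !pochhammerS mE -[r.+1%:R]natr1 -[i.+1%:R]natr1 in binE *.
  rewrite -/r; apply/subr0_eq.
  transitivity (pochhammer A i * (A + i%:R) * (pochhammer B i * (B + i%:R))
    * (pochhammer E r * (E + r%:R)) * pochhammer (A + B + E + (i%:R + 1)) r
    * ('C(m, i)%:R * (r%:R + 1) - 'C(m, i.+1)%:R * (i%:R + 1))); first by ring.
  by rewrite binE subrr mulr0.
rewrite sumrN telescope_sumr //= subr0.
by rewrite binn /t subnn !pochhammer0 !pochhammerS; ring.
Qed.

(** * Finite sums and the Gould-Hsu inversion *)

Lemma sum_nat_widen0 (V : nmodType) (u : nat -> V) m n :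
  (m <= n)%N -> (forall i, (m <= i)%N -> u i = 0) ->
  \sum_(0 <= i < m) u i = \sum_(0 <= i < n) u i.
Proof.
move=> mn u0; rewrite [RHS](big_cat_nat (n := m)) //= [X in _ + X]big_nat_cond.
by rewrite [X in _ + X]big1 ?addr0 // => i; rewrite andbT => /andP[/u0].
Qed.

Lemma sum_nat_double (V : nmodType) (u : nat -> V) n :
  \sum_(0 <= j < n.*2) u j
  = \sum_(0 <= k < n) u k.*2 + \sum_(0 <= k < n) u k.*2.+1.
Proof.
rewrite -big_split /=; elim: n => [|n IH]; first by rewrite !big_geq.
by rewrite doubleS !big_nat_recr //= IH addrA.
Qed.

(** The Gould-Hsu inverse pair, in the direction that needs only the factors at
    x = n to be nonzero.  After substituting the inner sum, the coefficient of
    g i is a sum over k which telescopes for i < n because the affine factor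
    interpolates:
      (n - i)(a_k + k b_k) = (k - i)(a_k + n b_k) + (n - k)(a_k + i b_k);
    for i = n the single term k = n remains. *)
Lemma gould_hsu (F : numFieldType) (a b g : nat -> F) n :
  let phi x m := \prod_(0 <= i < m) (a i + x * b i) in
  (forall k, (k <= n)%N -> a k + n%:R * b k != 0) ->
  g n = \sum_(0 <= k < n.+1)
    (-1) ^+ k * 'C(n, k)%:R * (a k + k%:R * b k) / phi n%:R k.+1
    * (\sum_(0 <= i < k.+1) (-1) ^+ i * 'C(k, i)%:R * phi i%:R k * g i).
Proof.
move=> phi nz; symmetry.
have phiS x m : phi x m.+1 = phi x m * (a m + x * b m).
  by rewrite /phi big_nat_recr.
have phi_neq0 m : (m <= n.+1)%N -> phi n%:R m != 0.
  elim: m => [_|m IH mn]; first by rewrite /phi big_geq ?oner_neq0.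
  by rewrite phiS mulf_neq0 ?nz // IH // ltnW.
pose w k i := (-1) ^+ k * 'C(n, k)%:R * (a k + k%:R * b k) / phi n%:R k.+1
    * ((-1) ^+ i * 'C(k, i)%:R * phi i%:R k).
transitivity (\sum_(0 <= k < n.+1) \sum_(0 <= i < n.+1) w k i * g i).
  apply: eq_big_nat => k /andP[_ kn].
  rewrite (@sum_nat_widen0 _ _ k.+1 n.+1) //; last first.
    by move=> i ki; rewrite bin_small // mulr0 !mul0r.
  by rewrite mulr_sumr; apply: eq_bigr => i _; rewrite /w -!mulrA.
rewrite exchange_big /= big_nat_recr //= [X in X + _]big_nat_cond big1 ?add0r.
  rewrite -mulr_suml big_nat_recr //= big_nat_cond big1 ?add0r; last first.
    by move=> k; rewrite andbT => /andP[_ kn]; rewrite /w (@bin_small k n) // mulr0 !mul0r mulr0.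
  rewrite /w binn phiS !mulr1 -[RHS]mul1r; congr (_ * _).
  have := signrMK n (1 : F); rewrite mulr1 => sgn.
  have h0 := phi_neq0 _ (leqnSn n); have h1 := nz n (leqnn n).
  transitivity ((-1) ^+ n * (-1) ^+ n : F) => //.
  by field; rewrite h0 h1.
move=> i; rewrite andbT => /andP[_ lt_in]; rewrite -mulr_suml.
have ni : n%:R - i%:R != 0 :> F by rewrite subr_eq0 eqr_nat gtn_eqF.
apply/eqP; rewrite mulf_eq0; apply/orP; left.
rewrite -(mulrI_eq0 _ (mulfI ni)) mulr_sumr.
pose H k := (-1) ^+ k * ('C(n, k)%:R * ((k%:R - i%:R) * 'C(k, i)%:R)) * phi i%:R k / phi n%:R k.
rewrite (eq_big_nat _ _ (F2 := fun k => - (-1) ^+ i * (H k.+1 - H k))); last first.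
  move=> k /andP[_]; rewrite ltnS => kn.
  have bin1 : (k.+1%:R - i%:R) * 'C(k.+1, i)%:R = k.+1%:R * 'C(k, i)%:R :> F.
    have [ik|ki] := leqP i k.+1; first by rewrite -natrB // -!natrM mul_bin_down.
    by rewrite !bin_small ?mulr0 // ltnW.
  have bin2 : 'C(n, k.+1)%:R * k.+1%:R = 'C(n, k)%:R * (n%:R - k%:R) :> F.
    by rewrite -natrB // -!natrM mulnC mul_bin_left mulnC.
  rewrite /H bin1 ['C(n, k.+1)%:R * (_ * _)]mulrA bin2 /w !phiS exprS.
  have h0 := phi_neq0 _ (leqW kn); have h1 := nz k kn.
  by field; rewrite h0 h1.
rewrite -mulr_sumr telescope_sumr // /H bin_small // bin0n.
by case: (i) => [|j]; rewrite ?subrr ?(mulr0, mul0r) ?subrr ?mulr0.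
Qed.

(** * The inverted sum *)

(** Here (2-c-i)_q / (c-1)_i is, up to a constant, 1 / (c-1-q)_i, and
    (c-a+i)_p (c-a)_i is, up to a constant, (c-a+p)_i.  The sum is then
    3F2(-m, c-a+p, a-b; 1-b, c-1-q; 1), balanced precisely since m = p+q+1. *)
Lemma binomial_transform (F : fieldType) (a b c : F) (p q : nat) :
  let m := (p + q.+1)%N in
  (forall k, 2 - c - m%:R + k%:R != 0) ->
  pochhammer c p != 0 -> pochhammer (1 - b) m != 0 ->
  \sum_(0 <= i < m.+1) (-1) ^+ i * 'C(m, i)%:R
    * ((1 - c) * pochhammer (2 - c - i%:R) q * pochhammer (c - a + i%:R) p)
    * (pochhammer (c - a) i * pochhammer (a - b) i
       / (pochhammer (c - 1) i * pochhammer (1 - b) i))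
  = pochhammer (1 - a) m * pochhammer (c - a) p * pochhammer (b + c - a) p
     * pochhammer (a - b - c + 1) q.+1
     / (pochhammer c p * pochhammer (1 - b) m).
Proof.
move=> m c_nz cp_nz b_nz.
have S := @saalschutz F (c - a + p%:R) (a - b) (1 - c - p%:R) m.
have AE : c - a + p%:R + (1 - c - p%:R) = 1 - a by ring.
have BE : a - b + (1 - c - p%:R) = 1 - (b + c - a) - p%:R by ring.
have ABE : c - a + p%:R + (a - b) + (1 - c - p%:R) = 1 - b by ring.
rewrite AE BE ABE {}/m in c_nz b_nz S *.
rewrite [pochhammer (1 - (b + c - a) - p%:R) _]pochhammerD pochhammerN subrK in S.
have -> : a - b - c + 1 = 1 - (b + c - a) by ring.
have sgn k : (-1) ^+ k * (-1) ^+ k = 1 :> F by rewrite -[X in _ * X]mulr1 signrMK.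
transitivity (pochhammer (c - a) p * (-1) ^+ p / (pochhammer c p * pochhammer (1 - b) (p + q.+1))
   * (pochhammer (1 - a) (p + q.+1) * ((-1) ^+ p * pochhammer (b + c - a) p *
       pochhammer (1 - (b + c - a)) q.+1))); last first.
  have := sgn p; set s := _ ^+ p => sp.
  rewrite -[RHS]mul1r -[X in _ = X * _]sp.
  by ring.
rewrite -S mulr_sumr; apply: eq_big_nat => i /andP[_]; rewrite ltnS => im.
set m := (p + q.+1)%N in c_nz b_nz im *.
have h1 : pochhammer (c - a) i * pochhammer (c - a + i%:R) p
   = pochhammer (c - a) p * pochhammer (c - a + p%:R) i.
  by rewrite -!pochhammerD addnC.
have h2 : pochhammer (1 - b) i * pochhammer (1 - b + i%:R) (m - i) = pochhammer (1 - b) m.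
  by rewrite -pochhammerD subnKC.
have h3 : pochhammer (c - 1) i = (-1) ^+ i * pochhammer (2 - c - i%:R) i.
  have -> : 2 - c - i%:R = 1 - (c - 1) - i%:R by ring.
  by rewrite pochhammerN mulrA sgn mul1r.
have shift_nz j k : (j <= m)%N -> 2 - c - j%:R + k%:R != 0.
  move=> jm; have := c_nz (m - j + k)%N.
  by rewrite natrD natrB // addrA addrACA; congr (_ != 0); ring.
(* Up to sign and a factor independent of i, (1-c-p)_{m-i} is 1 / (c-1-q)_i. *)
have h4 : (1 - c) * pochhammer (2 - c - i%:R) q * (pochhammer c p * (-1) ^+ p)
    = pochhammer (2 - c - i%:R) i * pochhammer (1 - c - p%:R) (m - i).
  have X_nz : pochhammer (2 - c - i%:R + q%:R) i != 0.
    apply: pochhammer_neq0 => k _; rewrite -addrA -natrD.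
    exact: shift_nz.
  (* Multiplication by this symbol merges those in c on either side into
     consecutive factors, whichever of i and q is larger. *)
  apply: (mulIf X_nz).
  have e1 : pochhammer (2 - c - i%:R) q * pochhammer (2 - c - i%:R + q%:R) i
      = pochhammer (2 - c - i%:R) i * pochhammer (2 - c) q.
    by rewrite -pochhammerD addnC pochhammerD subrK.
  have e2 : pochhammer (1 - c - p%:R) (m - i) * pochhammer (2 - c - i%:R + q%:R) i
     = (-1) ^+ p * pochhammer c p * ((1 - c) * pochhammer (2 - c) q).
    have -> : 2 - c - i%:R + q%:R = 1 - c - p%:R + (m - i)%:R.
      by rewrite natrB // /m natrD -natr1; ring.
    rewrite -pochhammerD subnK // /m pochhammerD pochhammerN subrK pochhammerSl.
    by have -> : 1 - c + 1 = 2 - c by ring.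
  rewrite -[RHS]mulrA e2.
  transitivity ((1 - c) * (pochhammer c p * (-1) ^+ p) * (pochhammer (2 - c - i%:R) q *
    pochhammer (2 - c - i%:R + q%:R) i)); first by ring.
  by rewrite e1; ring.
have nz3 : pochhammer (2 - c - i%:R) i != 0.
  by apply: pochhammer_neq0 => k _; apply: shift_nz.
have nz2 : pochhammer (1 - b) i != 0.
  by apply: contraNneq b_nz; rewrite -h2 => ->; rewrite mul0r.
have nz4 : (-1) ^+ i != 0 :> F by rewrite signr_eq0.
rewrite h3 -h2; rewrite -h2 in b_nz.
have nz5 : pochhammer (1 - b + i%:R) (m - i) != 0.
  by apply: contraNneq b_nz => ->; rewrite mulr0.
transitivity (((1 - c) * pochhammer (2 - c - i%:R) q * (pochhammer c p * (-1) ^+ p))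
  * (pochhammer (c - a) i * pochhammer (c - a + i%:R) p) * ((-1) ^+ p * 'C(m, i)%:R * pochhammer (a - b) i
   / (pochhammer c p * pochhammer (1 - b) i * pochhammer (2 - c - i%:R) i))).
  rewrite -[LHS]mul1r -[X in X * _ = _](sgn p).
  by field; rewrite cp_nz nz2 nz3 nz4.
rewrite h4 h1.
by field; rewrite cp_nz nz2 nz3 nz5.
Qed.

(** The affine factors are [factor_const a c j + x * factor_slope j]: 1-c at
    j = 0, then c-a+x+k at j = 2k+1 and 2-c-x+(k-1) at j = 2k > 0.  The constant
    term 1-c+k of the last one extends to j = 0, where only the slope differs. *)
Definition factor_const (C : nzRingType) (a c : C) (j : nat) : C :=
  (if odd j then c - a else 1 - c) + j./2%:R.

Definition factor_slope (C : nzRingType) (j : nat) : C :=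
  if odd j then 1 else if j is 0 then 0 else - 1.

Lemma prod_factorS (C : comNzRingType) (a c x : C) k :
  let phi m := \prod_(0 <= i < m) (@factor_const C a c i + x * factor_slope C i) in
  phi k.*2.+1 = (1 - c) * pochhammer (2 - c - x) k * pochhammer (c - a + x) k
  /\ phi k.*2.+2 = (1 - c) * pochhammer (2 - c - x) k * pochhammer (c - a + x) k.+1.
Proof.
move=> phi.
have phiS m : phi m.+1 = phi m * (@factor_const C a c m + x * factor_slope C m).
  by rewrite /phi big_nat_recr.
have odd_step m : phi m.*2.+2 = phi m.*2.+1 * (c - a + x + m%:R).
  rewrite phiS /factor_const /factor_slope /= odd_double /= uphalf_double.
  by congr (_ * _); ring.
rewrite odd_step; suff phi_odd : phi k.*2.+1 = (1 - c) * pochhammer (2 - c - x) k * pochhammer (c - a + x) k.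
  by split=> //; rewrite phi_odd pochhammerS mulrA.
elim: k => [|k IH].
  rewrite phiS /phi big_geq // /factor_const /factor_slope /= !pochhammer0; ring.
rewrite doubleS phiS odd_step IH /factor_const /factor_slope /= odd_double /= doubleK.
by rewrite !pochhammerS -natr1; ring.
Qed.

(** Gould-Hsu inversion of the binomial transform, with the sum over j <= n
    split by the parity of j.  Both sums may run to n since the binomial
    coefficients vanish beyond n/2. *)
Lemma even_odd_expansion (F : numFieldType) (n : nat) (a b c : F) :
  (forall k, c - 1 + k%:R != 0) -> (forall k, 2 - c - n%:R + k%:R != 0) ->
  (forall k, c - a + n%:R + k%:R != 0) -> (forall k, 1 - b + k%:R != 0) ->
  pochhammer (c - a) n * pochhammer (a - b) n
    / (pochhammer (c - 1) n * pochhammer (1 - b) n)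
  = \sum_(0 <= k < n.+1) 'C(n, k.*2)%:R
       * (pochhammer (1 - a) k.*2 * pochhammer (c - a) k
          * pochhammer (b + c - a) k * pochhammer (a - b - c + 1) k)
       / (pochhammer (1 - b) k.*2 * pochhammer (c - 1) k
          * pochhammer (2 - c - n%:R) k * pochhammer (c - a + n%:R) k)
  + \sum_(0 <= k < n.+1) 'C(n, k.*2.+1)%:R * (c - a + 1 + 3 * k%:R)
       * (pochhammer (1 - a) k.*2.+1 * pochhammer (c - a) k
          * pochhammer (b + c - a) k * pochhammer (a - b - c + 1) k.+1)
       / (pochhammer (1 - b) k.*2.+1 * pochhammer (c - 1) k.+1
          * pochhammer (2 - c - n%:R) k * pochhammer (c - a + n%:R) k.+1).
Proof.
move=> hc h2 hca hb.
have P x k (hx : forall i, x + i%:R != 0) : pochhammer x k != 0 :> F.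
  by apply: pochhammer_neq0 => i _.
have hc0 k : c + k%:R != 0.
  by have := hc k.+1; rewrite -natr1; congr (_ != 0); ring.
have c1 : 1 - c != 0 by rewrite -oppr_eq0 opprB; have := hc 0%N; rewrite addr0.
have c1E k : pochhammer (c - 1) k.+1 = - (1 - c) * pochhammer c k.
  by rewrite pochhammerSl subrK opprB.
have h2m m : (m <= n)%N -> forall k, 2 - c - m%:R + k%:R != 0.
  move=> mn k; have := h2 (n - m + k)%N.
  by rewrite natrD natrB //; congr (_ != 0); ring.
pose E k := 'C(n, k.*2)%:R
       * (pochhammer (1 - a) k.*2 * pochhammer (c - a) k
          * pochhammer (b + c - a) k * pochhammer (a - b - c + 1) k)
       / (pochhammer (1 - b) k.*2 * pochhammer (c - 1) k
          * pochhammer (2 - c - n%:R) k * pochhammer (c - a + n%:R) k).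
pose O k := 'C(n, k.*2.+1)%:R * (c - a + 1 + 3 * k%:R)
       * (pochhammer (1 - a) k.*2.+1 * pochhammer (c - a) k
          * pochhammer (b + c - a) k * pochhammer (a - b - c + 1) k.+1)
       / (pochhammer (1 - b) k.*2.+1 * pochhammer (c - 1) k.+1
          * pochhammer (2 - c - n%:R) k * pochhammer (c - a + n%:R) k.+1).
pose u j := if odd j then O j./2 else E j./2.
rewrite -/(E _) -/(O _).
transitivity (\sum_(0 <= j < n.+1) u j); last first.
  (* Extended by zero terms, the range has even length. *)
  rewrite (@sum_nat_widen0 _ u n.+1 n.+1.*2); first last.
  - move=> j nj; have e := odd_double_half j; rewrite /u; move: e.
    case: (odd j) => e; [rewrite /O; rewrite -[j./2.*2.+1]/(1 + j./2.*2)%N | rewrite /E].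
      by rewrite e (bin_small nj) !mul0r.
    by rewrite [j./2.*2]e (bin_small nj) !mul0r.
  - by rewrite -addnn leq_addr.
  rewrite sum_nat_double; congr (_ + _); apply: eq_bigr => k _.
    by rewrite /u odd_double doubleK.
  by rewrite /u /= odd_double /= uphalf_double.
have nz j : (j <= n)%N -> @factor_const F a c j + n%:R * factor_slope F j != 0.
  move=> _; rewrite /factor_const /factor_slope.
  case: j => [|j] /=; first by rewrite mulr0 !addr0.
  rewrite uphalf_half; case: (odd j) => /=.
    by have := h2 j./2; rewrite -nat1r; congr (_ != 0); ring.
  by have := hca j./2; congr (_ != 0); ring.
rewrite (@gould_hsu F (@factor_const F a c) (factor_slope F)
  (fun i => pochhammer (c - a) i * pochhammer (a - b) i
       / (pochhammer (c - 1) i * pochhammer (1 - b) i)) n nz).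
apply: eq_big_nat => j /andP[_]; rewrite ltnS => jn.
have [k jk] : exists k, j = k.*2.+1 \/ j = k.*2 by
  exists j./2; have := odd_double_half j; case: odd => e;
    [left | right]; rewrite -[LHS]e.
have sgn1 : (-1) ^+ k.*2 = 1 :> F by rewrite -signr_odd odd_double.
case: jk => jE; rewrite {j}jE in jn *.
  rewrite /u /= odd_double /= uphalf_double.
  rewrite (@prod_factorS F a c n%:R k).2.
  rewrite (eq_bigr (fun i => (-1) ^+ i * 'C(k.*2.+1, i)%:R
    * ((1 - c) * pochhammer (2 - c - i%:R) k * pochhammer (c - a + i%:R) k)
    * (pochhammer (c - a) i * pochhammer (a - b) i
       / (pochhammer (c - 1) i * pochhammer (1 - b) i)))); last first.
    by move=> i _; rewrite (@prod_factorS F a c i%:R k).1.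
  have kk : (k + k.+1)%N = k.*2.+1 by rewrite addnS addnn.
  rewrite -kk in jn *; rewrite (@binomial_transform F a b c k k) ?P //; last exact: h2m.
  rewrite /O kk exprS sgn1 c1E /factor_const /factor_slope /= odd_double /= uphalf_double.
  rewrite -natr1 -addnn natrD.
  by field; rewrite c1 !P.
(* j = 0 is apart: its product of factors is empty, without the factor 1-c. *)
case: k => [|k] in jn sgn1 *.
  rewrite /u /E /= double0 !big_nat1 !big_geq // !bin0 !pochhammer0 /factor_const /factor_slope /=.
  by field.
rewrite doubleS in jn sgn1 *.
rewrite /u /= odd_double /= doubleK.
have := (@prod_factorS F a c n%:R k.+1).1; rewrite doubleS => ->.
rewrite (eq_bigr (fun i => (-1) ^+ i * 'C(k.*2.+2, i)%:R
    * ((1 - c) * pochhammer (2 - c - i%:R) k * pochhammer (c - a + i%:R) k.+1)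
    * (pochhammer (c - a) i * pochhammer (a - b) i
       / (pochhammer (c - 1) i * pochhammer (1 - b) i)))); last first.
  by move=> i _; rewrite (@prod_factorS F a c i%:R k).2.
have kk : (k.+1 + k.+1)%N = k.*2.+2 by rewrite addnn.
rewrite -kk in jn *; rewrite (@binomial_transform F a b c k.+1 k) ?P //; last exact: h2m.
(* The weight a_j + j b_j = 1-c-k of an even index lowers the lower parameter c
   to c-1; odd indices have the weight c-a+1+3k, kept as it is. *)
have ck : 1 - c - k.+1%:R != 0.
  by have := hc k.+1; rewrite -oppr_eq0; congr (_ != 0); ring.
have c1E' : (1 - c) * pochhammer c k.+1 = pochhammer (c - 1) k.+1 * (1 - c - k.+1%:R).
  apply: oppr_inj; rewrite -!mulNr -c1E pochhammerS; ring.
rewrite /E doubleS kk sgn1 /factor_const /factor_slope /= odd_double /= doubleK.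
transitivity ('C(n, k.*2.+2)%:R
   * (pochhammer (1 - a) k.*2.+2 * pochhammer (c - a) k.+1 *
      pochhammer (b + c - a) k.+1 * pochhammer (a - b - c + 1) k.+1) * (1 - c - k.+1%:R)
  / (pochhammer (1 - b) k.*2.+2 * ((1 - c) * pochhammer c k.+1)
     * pochhammer (2 - c - n%:R) k.+1 * pochhammer (c - a + n%:R) k.+1)).
  rewrite -[X in _ + X%:R * _]kk natrD.
  by field; rewrite c1 !P.
rewrite c1E'; move: ck; set y := 1 - c - _ => y_nz.
by field; rewrite y_nz !P.
Qed.

(** * Terms of the two series *)

(** Convergence is trivial here: the partial sums are eventually constant, and
    the complex plane is Hausdorff. *)
Lemma hypergeom_terminating (R : realType) (us ls : seq R[i]) (z : R[i]) N :
  (forall k, (N <= k)%N -> hypergeom_term us ls z k = 0) ->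
  hypergeom us ls z = \sum_(0 <= k < N) hypergeom_term us ls z k.
Proof.
move=> h; rewrite /hypergeom; apply: (@lim_near_cst R[i]^o (@norm_hausdorff _ R[i]^o)).
near=> m; rewrite /series /=; symmetry; apply: sum_nat_widen0 => //.
by near: m; exists N.
Unshelve. all: by end_near. Qed.

Lemma term_7F6 (F : numFieldType) (n k : nat) (a b c : F) :
  (forall i, c - 1 + i%:R != 0) -> (forall i, 2 - c - n%:R + i%:R != 0) ->
  (forall i, c - a + n%:R + i%:R != 0) -> (forall i, 1 - b + i%:R != 0) ->
  hypergeom_term
      [:: - (n%:R / 2); (1 - n%:R) / 2; (1 - a) / 2;
          (2 - a) / 2; c - a; b + c - a; a - b - c + 1]
      [:: 1 / 2; (1 - b) / 2; (2 - b) / 2; c - 1;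
          2 - c - n%:R; c - a + n%:R]
      1 k
  = 'C(n, k.*2)%:R
       * (pochhammer (1 - a) k.*2 * pochhammer (c - a) k
          * pochhammer (b + c - a) k * pochhammer (a - b - c + 1) k)
       / (pochhammer (1 - b) k.*2 * pochhammer (c - 1) k
          * pochhammer (2 - c - n%:R) k * pochhammer (c - a + n%:R) k).
Proof.
move=> hc h2 hca hb.
have P x m (hx : forall i, x + i%:R != 0) : pochhammer x m != 0 :> F.
  by apply: pochhammer_neq0 => i _.
have four : 4 ^+ k != 0 :> F by rewrite expf_neq0 ?pnatr_eq0.
have fact_nz m : m`!%:R != 0 :> F by rewrite pnatr_eq0 -lt0n fact_gt0.
have den : pochhammer (1 / 2) k * k`!%:R = k.*2`!%:R / 4 ^+ k :> F.
  by rewrite -!pochhammer1 (@pochhammer_halves F (1 / 2) 1) //; field.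
have num : pochhammer (- (n%:R / 2)) k * pochhammer ((1 - n%:R) / 2) k
   = 'C(n, k.*2)%:R * (pochhammer (1 / 2) k * k`!%:R) :> F.
  rewrite den (@pochhammer_halves F _ (- n%:R)); [|by field..].
  by rewrite pochhammer_oppn -signr_odd odd_double natrM; field.
have numa : pochhammer ((1 - a) / 2) k * pochhammer ((2 - a) / 2) k
   = pochhammer (1 - a) k.*2 / 4 ^+ k.
  by apply: pochhammer_halves; field.
have denb : pochhammer ((1 - b) / 2) k * pochhammer ((2 - b) / 2) k
   = pochhammer (1 - b) k.*2 / 4 ^+ k.
  by apply: pochhammer_halves; field.
have : pochhammer (1 / 2) k * k`!%:R != 0 :> F.
  by rewrite den mulf_neq0 ?invr_eq0.
have : pochhammer ((1 - b) / 2) k * pochhammer ((2 - b) / 2) k != 0.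
  by rewrite denb mulf_neq0 ?invr_eq0 // P.
rewrite !mulf_eq0 !negb_or => /andP[S1 S2] /andP[Q _].
rewrite /hypergeom_term !big_cons !big_nil expr1n.
transitivity ((pochhammer (- (n%:R / 2)) k * pochhammer ((1 - n%:R) / 2) k)
   * (pochhammer ((1 - a) / 2) k * pochhammer ((2 - a) / 2) k)
   * (pochhammer (c - a) k * pochhammer (b + c - a) k * pochhammer (a - b - c + 1) k)
   / ((pochhammer (1 / 2) k * k`!%:R)
      * (pochhammer ((1 - b) / 2) k * pochhammer ((2 - b) / 2) k)
      * (pochhammer (c - 1) k * pochhammer (2 - c - n%:R) k * pochhammer (c - a + n%:R) k))).
  by field; rewrite Q S1 S2 fact_nz !P.
rewrite num numa denb.
by field; rewrite Q fact_nz four !P.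
Qed.

(** The parameters 1 + y over y, with y = (c-a+1)/3, contribute (y+k)/y: this is
    the linear factor c-a+1+3k of the odd terms. *)
Lemma term_8F7 (F : numFieldType) (n k : nat) (a b c : F) :
  (forall i, c - 1 + i%:R != 0) -> (forall i, 2 - c - n%:R + i%:R != 0) ->
  (forall i, c - a + n%:R + i%:R != 0) -> (forall i, 1 - b + i%:R != 0) ->
  (forall i, (c - a + 1) / 3 + i%:R != 0) ->
  - (n%:R * (1 - a) * (c - a + 1) * (a - b - c + 1)
        / ((1 - b) * (1 - c) * (c - a + n%:R)))
  * hypergeom_term
          [:: (1 - n%:R) / 2; (2 - n%:R) / 2;
              1 + (c - a + 1) / 3; (2 - a) / 2; (3 - a) / 2;
              c - a; b + c - a; a - b - c + 2]
          [:: 3 / 2; (c - a + 1) / 3; (2 - b) / 2;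
              (3 - b) / 2; c; 2 - c - n%:R; c - a + n%:R + 1]
          1 k
  = 'C(n, k.*2.+1)%:R * (c - a + 1 + 3 * k%:R)
       * (pochhammer (1 - a) k.*2.+1 * pochhammer (c - a) k
          * pochhammer (b + c - a) k * pochhammer (a - b - c + 1) k.+1)
       / (pochhammer (1 - b) k.*2.+1 * pochhammer (c - 1) k.+1
          * pochhammer (2 - c - n%:R) k * pochhammer (c - a + n%:R) k.+1).
Proof.
move=> hc h2 hca hb h3.
have P x m (hx : forall i, x + i%:R != 0) : pochhammer x m != 0 :> F.
  by apply: pochhammer_neq0 => i _.
have next x (hx : forall i, x + i%:R != 0) : forall i, x + 1 + i%:R != 0 :> F.
  by move=> i; rewrite -addrA nat1r.
have hc0 : forall i, c + i%:R != 0.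
  by move=> i; have := next _ hc i; rewrite subrK.
have nz0 x (hx : forall i, x + i%:R != 0) : x != 0 :> F.
  by have := hx 0%N; rewrite addr0.
have c1 : 1 - c != 0 by rewrite -oppr_eq0 opprB nz0.
have hca1 := next _ hca; have wnz := nz0 _ hca.
have four : 4 ^+ k != 0 :> F by rewrite expf_neq0 ?pnatr_eq0.
have fact_nz m : m`!%:R != 0 :> F by rewrite pnatr_eq0 -lt0n fact_gt0.
have den : k`!%:R * pochhammer (3 / 2) k = k.*2.+1`!%:R / 4 ^+ k :> F.
  rewrite -!pochhammer1 pochhammerSl (@pochhammer_halves F 1 2); [|by field..].
  by rewrite mul1r.
have num : n%:R * (pochhammer ((1 - n%:R) / 2) k * pochhammer ((2 - n%:R) / 2) k)
   = 'C(n, k.*2.+1)%:R * (k`!%:R * pochhammer (3 / 2) k) :> F.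
  rewrite den (@pochhammer_halves F _ (- n%:R + 1)); [|by field..].
  have -> : n%:R * (pochhammer (- n%:R + 1) k.*2 / 4 ^+ k)
      = - pochhammer (- n%:R) k.*2.+1 / 4 ^+ k :> F.
    by rewrite pochhammerSl !mulNr opprK mulrA.
  rewrite pochhammer_oppn exprS -signr_odd odd_double mulr1 mulN1r opprK natrM.
  by rewrite mulrA.
have num3 : pochhammer (1 + (c - a + 1) / 3) k * (c - a + 1)
   = pochhammer ((c - a + 1) / 3) k * (c - a + 1 + 3 * k%:R).
  transitivity (3 * ((c - a + 1) / 3 * pochhammer ((c - a + 1) / 3 + 1) k)).
    by rewrite [1 + _]addrC; field.
  by rewrite -pochhammerSl pochhammerS; field.
have numa : (1 - a) * (pochhammer ((2 - a) / 2) k * pochhammer ((3 - a) / 2) k)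
   = pochhammer (1 - a) k.*2.+1 / 4 ^+ k.
  rewrite pochhammerSl -mulrA; congr (_ * _).
  by apply: pochhammer_halves; field.
have denb : (1 - b) * (pochhammer ((2 - b) / 2) k * pochhammer ((3 - b) / 2) k)
   = pochhammer (1 - b) k.*2.+1 / 4 ^+ k.
  rewrite pochhammerSl -mulrA; congr (_ * _).
  by apply: pochhammer_halves; field.
have : k`!%:R * pochhammer (3 / 2) k != 0 :> F.
  by rewrite den mulf_neq0 ?invr_eq0.
have : (1 - b) * (pochhammer ((2 - b) / 2) k * pochhammer ((3 - b) / 2) k) != 0.
  by rewrite denb mulf_neq0 ?invr_eq0 // P.
rewrite !mulf_eq0 !negb_or => /and3P[S0 S1 S2] /andP[_ Q].
have z1 : pochhammer (a - b - c + 1) k.+1 = (a - b - c + 1) * pochhammer (a - b - c + 2) k.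
  by rewrite pochhammerSl; have -> : a - b - c + 1 + 1 = a - b - c + 2 by ring.
have cE : pochhammer (c - 1) k.+1 = - ((1 - c) * pochhammer c k).
  by rewrite pochhammerSl subrK -mulNr opprB.
rewrite z1 cE [pochhammer (c - a + n%:R) k.+1]pochhammerSl.
rewrite /hypergeom_term !big_cons !big_nil expr1n.
transitivity (- ((n%:R * (pochhammer ((1 - n%:R) / 2) k * pochhammer ((2 - n%:R) / 2) k))
   * (pochhammer (1 + (c - a + 1) / 3) k * (c - a + 1))
   * ((1 - a) * (pochhammer ((2 - a) / 2) k * pochhammer ((3 - a) / 2) k))
   * (pochhammer (c - a) k * pochhammer (b + c - a) k
      * ((a - b - c + 1) * pochhammer (a - b - c + 2) k))
   / ((k`!%:R * pochhammer (3 / 2) k) * pochhammer ((c - a + 1) / 3) k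
      * ((1 - b) * (pochhammer ((2 - b) / 2) k * pochhammer ((3 - b) / 2) k))
      * ((1 - c) * pochhammer c k * pochhammer (2 - c - n%:R) k
         * ((c - a + n%:R) * pochhammer (c - a + n%:R + 1) k))))).
  by field; rewrite Q S0 S1 S2 c1 fact_nz wnz !P.
rewrite num num3 numa denb.
by field; rewrite Q fact_nz four c1 wnz !P.
Qed.

(** * The summation formula *)

Theorem theorem4p2 (R : realType) (n : nat) (a b c : R[i])
    (lower7F6 : {in [:: 1 / 2; (1 - b) / 2; (2 - b) / 2; c - 1;
                        2 - c - n%:R; c - a + n%:R],
                 forall x : R[i], ~ nonpos_integer x})
    (lower8F7 : {in [:: 3 / 2; (c - a + 1) / 3; (2 - b) / 2;
                        (3 - b) / 2; c; 2 - c - n%:R;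
                        c - a + n%:R + 1],
                 forall x : R[i], ~ nonpos_integer x})
    (denom_lhs : pochhammer (c - 1) n * pochhammer (1 - b) n != 0)
    (denom_rhs : (1 - b) * (1 - c) * (c - a + n%:R) != 0) :
  pochhammer (c - a) n * pochhammer (a - b) n
    / (pochhammer (c - 1) n * pochhammer (1 - b) n)
  = hypergeom
      [:: - (n%:R / 2); (1 - n%:R) / 2; (1 - a) / 2;
          (2 - a) / 2; c - a; b + c - a; a - b - c + 1]
      [:: 1 / 2; (1 - b) / 2; (2 - b) / 2; c - 1;
          2 - c - n%:R; c - a + n%:R]
      1
    - n%:R * (1 - a) * (c - a + 1) * (a - b - c + 1)
        / ((1 - b) * (1 - c) * (c - a + n%:R))
      * hypergeom
          [:: (1 - n%:R) / 2; (2 - n%:R) / 2;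
              1 + (c - a + 1) / 3; (2 - a) / 2; (3 - a) / 2;
              c - a; b + c - a; a - b - c + 2]
          [:: 3 / 2; (c - a + 1) / 3; (2 - b) / 2;
              (3 - b) / 2; c; 2 - c - n%:R; c - a + n%:R + 1]
          1.
Proof.
have lower (us : seq R[i]) (h : {in us, forall x : R[i], ~ nonpos_integer x}) x :
    x \in us -> forall k, x + k%:R != 0.
  move=> xus k; apply/eqP => xk; apply: (h x xus); exists k.
  exact: esym (addr0_eq (etrans (addrC _ _) xk)).
have hc : forall k, c - 1 + k%:R != 0.
  by move=> k; apply: (lower _ lower7F6); rewrite !inE eqxx ?orbT.
have h2 : forall k, 2 - c - n%:R + k%:R != 0.
  by move=> k; apply: (lower _ lower7F6); rewrite !inE eqxx ?orbT.
have hca : forall k, c - a + n%:R + k%:R != 0.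
  by move=> k; apply: (lower _ lower7F6); rewrite !inE eqxx ?orbT.
have h3 : forall k, (c - a + 1) / 3 + k%:R != 0.
  by move=> k; apply: (lower _ lower8F7); rewrite !inE eqxx ?orbT.
(* The two lower parameters (1-b)/2 and (2-b)/2 cover even and odd k. *)
have hb : forall k, 1 - b + k%:R != 0.
  have two : 2 != 0 :> R[i] by rewrite pnatr_eq0.
  move=> k; have := odd_double_half k; case: odd => <-.
    have := lower _ lower7F6 ((2 - b) / 2) _ k./2.
    rewrite !inE eqxx ?orbT => /(_ isT); apply: contra_neq => e.
    apply: (mulfI two).
    rewrite mulr0 -e natrD -addnn natrD /=.
    by field.
  have := lower _ lower7F6 ((1 - b) / 2) _ k./2.
  rewrite !inE eqxx ?orbT => /(_ isT); apply: contra_neq => e.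
  apply: (mulfI two).
  rewrite mulr0 -e add0n -addnn natrD.
  by field.
rewrite (@even_odd_expansion R[i] n a b c hc h2 hca hb).
have even_term k := @term_7F6 R[i] n k a b c hc h2 hca hb.
have odd_term k := @term_8F7 R[i] n k a b c hc h2 hca hb h3.
congr (_ + _).
  rewrite (@hypergeom_terminating _ _ _ _ n.+1); last first.
    move=> k nk; rewrite even_term bin_small ?mul0r //.
    by rewrite -addnn (leq_trans nk) // leq_addr.
  by apply: eq_bigr => k _; rewrite even_term.
(* For n = 0 the 8F7 need not terminate; it disappears with its
   coefficient n. *)
have [n0|n_gt0] := posnP n.
  rewrite {1}n0 big_nat1 n0 bin_small // !mul0r; ring.
set coef := _ / _.
rewrite (@hypergeom_terminating _ _ _ _ n.+1); last first.
  move=> k nk.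
  (* The upper parameters (1-n)/2, (2-n)/2 end the series; the prefactor may
     vanish, so this cannot be read off from [odd_term]. *)
  have top0 : pochhammer ((1 - n%:R) / 2) k * pochhammer ((2 - n%:R) / 2) k
      = 0 :> R[i].
    rewrite (@pochhammer_halves R[i] _ (- n.-1%:R)); first last.
    - by field.
    - by rewrite -subn1 natrB //; field.
    rewrite pochhammer_oppn bin_small ?mul0n ?mulr0 ?mul0r //.
    by rewrite -addnn (leq_trans _ (leq_addr _ _)) // (leq_trans _ nk) // ltnS leq_pred.
  by rewrite /hypergeom_term !big_cons mulrA top0 !mul0r.
rewrite -mulNr mulr_sumr; apply: eq_bigr => k _; exact: esym (odd_term k).
Qed.
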